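(* Every ray space is a $D$-space; that is, for every order-theoretic tree $T$, the ray space $\mathcal R(T)$ is a $D$-space.
   Context: An order-theoretic tree is a partially ordered set $(T,<)$ such that for every $t\in T$ the set $\{s\in T: s<t\}$ is well-ordered by $<$. A ray of $T$ is a nonempty downward closed chain $R\subseteq T$ with no maximal element (it need not be a maximal chain). The ray space $\mathcal R(T)$ is the set of all rays of $T$, topologized as a subspace of $\mathcal P(T)\cong 2^T$ with the product topology; i.e. a subbasis is given by the sets $[t]=\{R\in\mathcal R(T): t\in R\}$ and $\mathcal R(T)\setminus[t]$, for $t\in T$. A topological space $X$ is a $D$-space if for every open neighborhood assignment $(U_x:x\in X)$ (i.e. each $U_x$ is an open set containing $x$) there is a closed discrete set $D\subseteq X$ with $\bigcup_{x\in D}U_x=X$. *)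

(* Defs.v *)
From mathcomp Require Import all_boot all_order.
From mathcomp Require Import all_classical all_analysis.
From mathcomp Require Import wochoice.

Set Implicit Arguments.
Unset Strict Implicit.
Unset Printing Implicit Defensive.

Import Order.TTheory.

Local Open Scope classical_set_scope.
Local Open Scope order_scope.

(* [wo_chain] asks for least elements with respect to [<=], which for subsets
   of a partial order amounts to being well-ordered by [<]. *)
Definition is_tree d (T : porderType d) : Prop :=
  forall t : T, wo_chain <=%O [pred s | s < t].

Definition is_ray d (T : porderType d) (R : set T) : Prop :=
  [/\ R !=set0,
      forall s t : T, s <= t -> R t -> R s,
      total_on R <=%O &
      ~ exists2 t, R t & forall s, R s -> t <= s -> s = t].

(* A term of [powerset_space T] is a [set T] : classically [Prop] has exactly
   two elements, so this is the product 2^T of discrete two-point spaces. *)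
Definition powerset_space (T : Type) : topologicalType :=
  prod_topology (fun _ : T => discrete_topology Prop).

Definition ray_space d (T : porderType d) : topologicalType :=
  set_type [set R : powerset_space T | @is_ray d T R].

(* [D `<=` isolated D] says that the subspace topology on [D] is discrete. *)
Definition D_space (X : topologicalType) : Prop :=
  forall U : X -> set X, (forall x, open_nbhs x (U x)) ->
  exists D : set X,
    [/\ closed D, D `<=` isolated D & \bigcup_(x in D) U x = [set: X]].

(* Main.v *)
Require Import Defs.
From mathcomp Require Import all_boot all_order.
From mathcomp Require Import all_classical all_analysis.
From mathcomp Require Import wochoice.

Set Implicit Arguments.
Unset Strict Implicit.
Unset Printing Implicit Defensive.

Import Order.TTheory.

Local Open Scope classical_set_scope.
Local Open Scope order_scope.

(** Write [[t]] for the set of rays through [t] and [U] for the neighborhood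
assignment.  The neighborhood [U R] of a ray [R] contains [[t]] minus the sets [[f]]
for finitely many [f] lying above all of [R], for some [t] in [R]
([nbhs_ray_cone]); say then that [t] guards [R], and call [t] good when it
guards some ray.  Every later element of a ray also guards it.

The key step ([all_coverable]) is that for every [t] finitely many sets [U R],
with [R] in [[t]], cover [[t]] up to finitely many sets [[b]] with [t <= b] and
[b] not good.  If this failed, take a maximal chain of elements where it fails.
Some element [c] of the chain guards a ray [R] such that everything above [R] is
above the whole chain: when the chain has a maximum [c], this maximum is good, and
otherwise the downward closure of the chain is itself a ray and is guarded by some
[c] in it.  Now [U R] covers [[c]] up to finitely many [[f]] with [f] above [R], hence above the whole chain.  Since the statement fails
at [c] it fails at one of these [f], and the chain was not maximal.

Let [S a] and [B a] be the finite sets of rays and of non-good elements obtained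
at [a].  Call nodes the elements produced by starting with the minimal good
elements and passing from a node [p] to the minimal good elements above some
element of [B p].  The set [D] is the union of the [S a] over all nodes [a].

Every ray [Q] contains a node [a] such that [Q] avoids [B a] ([last_node]).
Otherwise the nodes in [Q] form a nonempty chain without maximum; its downward
closure is a ray, some node [a] in it guards it, and then so does an element of
[B a] lying between [a] and the next node, although elements of [B a] are not
good.  Therefore [S a] provides a member of [D] whose neighborhood contains [Q].
Moreover, the open set [[a]] minus the [[b]] for [b] in [B a] meets [S c] only for
nodes [c] below or equal to [a], because larger nodes lie above some element of
[B a] ([node_lt_above]); and the nodes up to [a] are finitely many ([node_finite_below]).
So [D] is locally finite, hence closed and discrete, the space being T1. *)

(** * Order-theoretic trees *)

Section Tree.
Context {d : Order.disp_t} {T : porderType d} (hT : is_tree T).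
Implicit Types (s t r : T) (X : set T).

Lemma tree_comparable s r t : s <= t -> r <= t -> s <= r \/ r <= s.
Proof.
rewrite le_eqVlt => /predU1P[->|st]; first by right.
rewrite le_eqVlt => /predU1P[->|rt]; first by left; exact: ltW.
by case/orP: (wo_chainW (@hT t) st rt); [left|right].
Qed.

Lemma tree_min X : X !=set0 -> exists2 x, X x & forall y, y < x -> ~ X y.
Proof.
move=> [t Xt]; have [none|/existsNP[s]] := pselect (forall s, s < t -> ~ X s).
  by exists t.
move=> /not_implyP[st /contrapT Xs].
have [] := @hT t [pred x | (x < t) && `[< X x >]].
- by move=> x /andP[].
- by exists s; rewrite inE st; exact/asboolP.
move=> x [[/andP[xt /asboolP Xx] xmin] _]; exists x => // y yx Xy.
have := xmin y; rewrite inE (lt_trans yx xt) => /(_ (asboolT Xy)).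
by rewrite (lt_geF yx).
Qed.

(** Any maximal element of the closure would lie in the chain itself, which has
none; two elements of the closure lie below a common element of the chain, so
the tree order compares them. *)
Lemma chain_down_ray (C : set T) : C !=set0 -> total_on C <=%O ->
  (forall c, C c -> exists2 c', C c' & c < c') ->
  is_ray [set s | exists2 c, C c & s <= c].
Proof.
move=> [c0 Cc0] Ctot Cnomax; split.
- by exists c0, c0.
- by move=> s t st [c Cc tc]; exists c => //; exact: le_trans tc.
- move=> s t [c Cc sc] [c' Cc' tc'].
  have [cc'|c'c] := Ctot _ _ Cc Cc'.
    exact: (tree_comparable (le_trans sc cc') tc').
  exact: (tree_comparable sc (le_trans tc' c'c)).
- move=> [t [c Cc tc] tmax]; have [c' Cc' cc'] := Cnomax c Cc.
  have tc' : t < c' by exact: le_lt_trans cc'.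
  have /esym/eqP := tmax c' (ex_intro2 _ _ c' Cc' (lexx c')) (ltW tc').
  by rewrite (lt_eqF tc').
Qed.

End Tree.

(** Zorn's lemma on the subchains of [N].  The last clause is maximality in the
form used for extending the chain at its top. *)
Lemma maximal_chain {d : Order.disp_t} {T : porderType d} (N : set T) : N !=set0 ->
  exists C, [/\ C !=set0, C `<=` N, total_on C <=%O
    & forall t, N t -> (forall c, C c -> c <= t) -> C t].
Proof.
move=> [n Nn].
have [F FP Ftot|C [[CN Ctot] Cmax]] :=
  @Zorn_bigcup T [set C | C `<=` N /\ total_on C <=%O].
  split=> [t [X /FP[XN _] Xt]|s t [X FX Xs] [Y FY Yt]]; first exact: XN.
  have [XY|YX] := Ftot _ _ FX FY.
    by have [_ Ytot] := FP _ FY; apply: Ytot => //; exact: XY.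
  by have [_ Xtot] := FP _ FX; apply: Xtot => //; exact: YX.
have Cext t : N t -> (forall c, C c -> c <= t) -> C t.
  move=> Nt Ct; apply: contrapT => nCt.
  apply: (Cmax (C `|` [set t])).
    split; first by move=> s Cs; left.
    by move=> /(_ t); apply: contra_not nCt => /=; apply; right.
  split=> [s [/CN //|-> //]|r s [Cr|->] [Cs|->]].
  - exact: Ctot.
  - by left; exact: Ct.
  - by right; exact: Ct.
  - by left.
exists C; split => //.
apply: contrapT => /set0P/negP; rewrite negbK => /eqP C0.
by have := Cext n Nn; rewrite C0; apply.
Qed.

Lemma filter_bigcap_finite {S I : Type} (F : set_system S) (A : set I)
    (P : I -> set S) : Filter F ->
  finite_set A -> (forall i, A i -> F (P i)) -> F (\bigcap_(i in A) P i).
Proof.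
elim/Pchoice: I => I in A P *.
move=> FF /finite_fsetP[X ->] FP; exact: filter_bigI.
Qed.

(** * The topology of the ray space *)

Section RayTopology.
Context {d : Order.disp_t} {T : porderType d}.
Implicit Types (s t f : T) (Q R : ray_space T).

Definition ray_set R : set T := set_val R.

Lemma ray_setP R : is_ray (ray_set R).
Proof. exact: set_valP. Qed.

Lemma ray_of_set (X : set T) : is_ray X -> exists R, ray_set R = X.
Proof. by move=> hX; exists (exist _ X (mem_set hX)). Qed.

Lemma ray_set_inj : injective ray_set.
Proof. exact: val_inj. Qed.

Lemma ray_down R s t : s <= t -> ray_set R t -> ray_set R s.
Proof. by have [_ + _ _] := ray_setP R; apply. Qed.

Lemma ray_total R : total_on (ray_set R) <=%O.
Proof. by have [] := ray_setP R. Qed.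

Lemma near_ray_mem t R : \forall Q \near R, ray_set Q t = ray_set R t.
Proof.
pose K (_ : T) : topologicalType := discrete_topology Prop.
apply: (@initial_continuous _ (powerset_space T) set_val R
          [set X : powerset_space T | X t = ray_set R t]).
apply: (@proj_continuous T K t (ray_set R) [set p | p = ray_set R t]).
exact: discrete_set1.
Qed.

Lemma near_ray_avoid (F : set T) R : finite_set F ->
  (forall f, F f -> ~ ray_set R f) ->
  \forall Q \near R, forall f, F f -> ~ ray_set Q f.
Proof.
move=> Ffin FR.
have := @filter_bigcap_finite _ _ (nbhs R) F (fun f Q => ~ ray_set Q f) _ Ffin.
apply => f Ff; apply: filterS (near_ray_mem f R) => Q ->; exact: FR.
Qed.

(** A product topology is the coarsest one making the coordinates continuous, so
convergence of filters of rays can be tested coordinatewise; the coordinates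
take values in a discrete space. *)
Lemma ray_cvg (G : set_system (ray_space T)) R : Filter G ->
  (forall t, \forall Q \near G, ray_set Q t = ray_set R t) -> G --> R.
Proof.
move=> FG Gt A [_ [[B oB <-] BR BA]].
have: (@set_val _ _ : ray_space T -> powerset_space T) @ G -->
    (ray_set R : powerset_space T).
  apply/cvg_sup => t V [_ [[W oW <-] WR WV]].
  by apply: filterS (Gt t) => Q QR; apply: WV; rewrite /= [X in W X]QR.
by move=> /(_ B (open_nbhs_nbhs (conj oB BR))); apply: (filterS BA).
Qed.

Definition ray_cone t (F : set T) : set (ray_space T) :=
  [set Q | ray_set Q t /\ forall f, F f -> ~ ray_set Q f].

Definition above_ray R f := forall r, ray_set R r -> r < f.

(** The sets containing such a cone form a filter, and by [ray_cvg] it suffices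
that this filter decides membership of each [t].  Only [t] outside [R] matters:
if [t] is above [R], exclude it explicitly; if not, some [r] in [R] is not below
[t], and a ray through [r] and [t] would force [t <= r], hence [t] in [R]. *)
Lemma nbhs_ray_cone R (A : set (ray_space T)) : nbhs R A ->
  exists t F, [/\ ray_set R t, finite_set F, F `<=` above_ray R
                & ray_cone t F `<=` A].
Proof.
pose G : set_system (ray_space T) := [set A |
  exists t F, [/\ ray_set R t, finite_set F, F `<=` above_ray R
                & ray_cone t F `<=` A]].
suff GR : G --> R by exact: GR.
apply: ray_cvg.
  split.
  - have [[t Rt] _ _ _] := ray_setP R.
    by exists t, set0; split.
  - move=> A1 A2 [t1 [F1 [Rt1 fin1 F1R sub1]]] [t2 [F2 [Rt2 fin2 F2R sub2]]].
    wlog le12 : A1 A2 t1 t2 F1 F2 Rt1 fin1 F1R sub1 Rt2 fin2 F2R sub2 / t1 <= t2.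
      move=> H; have [|] := ray_total Rt1 Rt2; first exact: (H A1 A2 t1 t2 F1 F2).
      by rewrite setIC; exact: (H A2 A1 t2 t1 F2 F1).
    exists t2, (F1 `|` F2); split => //.
    + by rewrite finite_setU.
    + by move=> f [/F1R|/F2R].
    + move=> Q [Qt Qf]; split.
        apply: sub1; split; first exact: ray_down Qt.
        by move=> f Ff; apply: Qf; left.
      by apply: sub2; split => // f Ff; apply: Qf; right.
  - move=> A1 A2 sA [t [F [? ? ? sub]]]; exists t, F; split => //.
    exact: subset_trans sA.
move=> t; have [Rt|nRt] := pselect (ray_set R t).
  exists t, set0; split => // Q [Qt _].
  exact/propext.
have [[t0 Rt0] _ _ _] := ray_setP R.
have [tR|/existsNP[r /not_implyP[Rr ntr]]] := pselect (above_ray R t).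
  exists t0, [set t]; split => // [|Q [_ Qt]]; first by move=> _ ->.
  by apply/propext; split => // Qtt; have := Qt t erefl.
exists r, set0; split => // Q [Qr _].
apply/propext; split => // Qt; exfalso.
have [rt|tr] := ray_total Qr Qt; last exact/nRt/(ray_down tr).
by apply: ntr; rewrite lt_neqAle rt andbT; apply: contra_notN nRt => /eqP<-.
Qed.

(** The ray space is T1, so a neighborhood of [Q] that meets [D] in a finite set
can be shrunk until it meets [D] at most in [Q]. *)
Lemma locally_finite_closed_discrete (D : set (ray_space T)) :
  (forall Q, exists2 W, nbhs Q W & finite_set (W `&` D)) ->
  closed D /\ D `<=` isolated D.
Proof.
move=> Dfin.
have sep Q : exists2 V, nbhs Q V & V `&` D `<=` [set Q].
  have [W QW WD] := Dfin Q.
  have near_ne : \forall P \near Q, forall R, ((W `&` D) `\ Q) R -> P <> R.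
    have := @filter_bigcap_finite _ _ (nbhs Q) ((W `&` D) `\ Q)
      (fun R P => P <> R) _ (finite_setD _ WD).
    apply => R [_ /= RQ].
    have /existsNP[t tP] : ~ forall t, ray_set R t = ray_set Q t.
      by move=> RQt; apply: RQ; apply: ray_set_inj; exact/funext.
    by apply: filterS (near_ray_mem t Q) => P + PR; rewrite PR => /tP.
  exists (W `&` [set P | forall R, ((W `&` D) `\ Q) R -> P <> R]).
    exact: filterI.
  by move=> P [[WP ne] DP]; apply: contrapT => PQ; exact: (ne P).
split=> [Q clQ|Q DQ]; have [V QV VD] := sep Q.
  by have [P [DP VP]] := clQ _ QV; rewrite -(VD P).
split; first exact: mem_set.
exists V => //; apply/seteqP; split => // _ ->; split => //.
exact: nbhs_singleton QV.
Qed.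

End RayTopology.

(** * Finite covers of cones up to non-good elements *)

Section Cover.
Context {d : Order.disp_t} {T : porderType d} (hT : is_tree T).
Context (U : ray_space T -> set (ray_space T)).
Context (hU : forall R, nbhs R (U R)).
Implicit Types (s t f : T) (Q R : ray_space T).

(** The rays through [t] that [U R] misses all pass through [F].  Requiring [F] to
lie above the whole of [R] is what makes an element of [F] extend every chain that
generates [R]. *)
Definition guards t R := ray_set R t /\
  exists F, [/\ finite_set F, F `<=` above_ray R & ray_cone t F `<=` U R].

Lemma guards_ex R : exists t, guards t R.
Proof.
have [t [F [Rt Ffin FR sub]]] := nbhs_ray_cone (hU R).
by exists t; split => //; exists F.
Qed.

Lemma guards_le s t R : guards s R -> s <= t -> ray_set R t -> guards t R.
Proof.
move=> [Rs [F [Ffin FR sub]]] st Rt; split => //; exists F; split => //.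
by move=> Q [Qt QF]; apply: sub; split => //; exact: ray_down Qt.
Qed.

Definition good t := exists R, guards t R.

(** The exceptional cones start at elements that are not good: this is what makes
the iteration over nodes stop along every ray. *)
Definition fin_cover t (S : set (ray_space T)) (B : set T) :=
  [/\ finite_set S /\ finite_set B,
      forall R, S R -> ray_set R t,
      forall b, B b -> t <= b /\ ~ good b &
      forall Q, ray_set Q t ->
        (exists2 R, S R & U R Q) \/ (exists2 b, B b & ray_set Q b)].

Definition coverable t := exists S B, fin_cover t S B.

Lemma not_good_coverable t : ~ good t -> coverable t.
Proof.
move=> ngt; exists set0, [set t]; split => //.
- by move=> _ ->.
- by move=> Q Qt; right; exists t.
Qed.

(** The set [U R] leaves only the cones of finitely many [f] above [R], whose
finite covers are put together. *)
Lemma guards_coverable t R : guards t R ->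
  (forall f, above_ray R f -> coverable f) -> coverable t.
Proof.
move=> [Rt [F [Ffin FR sub]]] cov.
have : forall f, exists SB, F f -> fin_cover f SB.1 SB.2.
  move=> f; have [/FR/cov[S [B SB]]|] := pselect (F f); first by exists (S, B).
  by exists (set0, set0).
move=> /choice[g gP].
exists (R |` \bigcup_(f in F) (g f).1), (\bigcup_(f in F) (g f).2); split.
- rewrite finite_setU; split; first split => //.
    by apply: bigcup_finite => // f /gP[[]].
  by apply: bigcup_finite => // f /gP[[]].
- move=> Q [->//|[f Ff SQ]]; have [_ /(_ Q SQ) Qf _ _] := gP f Ff.
  by apply: ray_down Qf; exact: ltW (FR f Ff t Rt).
- move=> b [f Ff Bb]; have [_ _ /(_ b Bb)[fb ngb] _] := gP f Ff.
  split => //; apply: le_trans fb; exact: ltW (FR f Ff t Rt).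
- move=> Q Qt; have [QF|/existsNP[f /not_implyP[Ff /contrapT Qf]]] :=
    pselect (forall f, F f -> ~ ray_set Q f).
    by left; exists R; [left|apply: sub].
  have [_ _ _ /(_ Q Qf)] := gP f Ff.
  move=> [[R' SR' UQ]|[b Bb Qb]].
    by left; exists R' => //; right; exists f.
  by right; exists b => //; exists f.
Qed.

(** A maximal chain of counterexamples contains some [c] guarding a ray [R] such
that everything above [R] is above the whole chain.  Since [c] is a
counterexample, so is some [f] above [R], which would extend the chain. *)
Lemma all_coverable t : coverable t.
Proof.
apply: contrapT => nt.
have [|C [[c0 Cc0] CN Ctot Cmax]] := @maximal_chain _ T [set s | ~ coverable s].
  by exists t.
have [c [R [Cc gR Rub]]] : exists c R, [/\ C c, guards c R &
    forall f, above_ray R f -> forall c', C c' -> c' < f].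
  (* A greatest [c] is good, as non-good elements are trivially coverable; a chain
     without maximum generates a ray, guarded from some [c] on. *)
  have [[c Cc cmax]|nomax] := pselect (exists2 c, C c & forall c', C c' -> c' <= c).
    have [R gR] : good c by apply: contrapT => /not_good_coverable; exact: CN.
    exists c, R; split => // f Rf c' /cmax/le_lt_trans; apply.
    by apply: Rf; case: gR.
  have Cnomax c : C c -> exists2 c', C c' & c < c'.
    move=> Cc; apply: contrapT => nc'; apply: nomax; exists c => // c' Cc'.
    have [//|] := Ctot _ _ Cc' Cc; rewrite le_eqVlt => /predU1P[->//|cc'].
    by exfalso; apply: nc'; exists c'.
  have [R RE] := ray_of_set (chain_down_ray hT (ex_intro _ c0 Cc0) Ctot Cnomax).
  have [s gs] := guards_ex R.
  have [c Cc sc] : exists2 c, C c & s <= c by case: gs; rewrite RE.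
  have CR c' : C c' -> ray_set R c' by move=> Cc'; rewrite RE; exists c'.
  exists c, R; split => //; first exact: guards_le gs sc (CR c Cc).
  by move=> f Rf c' /CR/Rf.
apply: (CN c Cc); apply: guards_coverable gR _ => f Rf.
apply: contrapT => nf.
have Cf : C f by apply: Cmax => // c' Cc'; exact/ltW/(Rub f).
by have := Rub f Rf f Cf; rewrite ltxx.
Qed.

End Cover.

(** * The tree of nodes *)

Section Nodes.
Context {d : Order.disp_t} {T : porderType d} (hT : is_tree T).
Context (good : set T) (B : T -> set T).
Implicit Types (a b c p : T).

Definition up_closure (X : set T) : set T := [set t | exists2 b, X b & b <= t].

Definition first_good (X : set T) a :=
  [/\ X a, good a & forall c, c < a -> X c -> ~ good c].

(** The elements at which finite covers are used: those good elements where a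
ray enters the part of the space left uncovered by the nodes before. *)
Inductive node : T -> Prop :=
| node_root a : first_good setT a -> node a
| node_next p a : node p -> first_good (up_closure (B p)) a -> node a.

Context (B_gt : forall a b, node a -> B a b -> a < b).

Lemma node_good a : node a -> good a.
Proof. by case=> [{}a []|p {}a _ []]. Qed.

Lemma up_closure_le (X : set T) s t : s <= t -> up_closure X s -> up_closure X t.
Proof. by move=> st [b Xb bs]; exists b => //; exact: le_trans st. Qed.

(** Consider a minimal [a'] at which this fails for some node [a], and let [p] be
the node from which [a'] arises.  The elements [a] and [p] are comparable, being
below [a'].  If [a <= p], minimality applied to [a] and [p] puts [p], hence [a'],
above [B a].  If [p < a], minimality puts [a] above [B p], so that the good element
[a < a'] contradicts the choice of [a'] as minimal. *)
Lemma node_lt_above a a' : node a -> node a' -> a < a' -> up_closure (B a) a'.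
Proof.
move=> na na' aa'; apply: contrapT => nB.
pose bad := [set a' | node a' /\ exists a, [/\ node a, a < a' & ~ up_closure (B a) a']].
have [|{na na' aa' nB} {}a' [na' [{}a [na aa' nB]]] bad_min] := @tree_min d T hT bad.
  by exists a'; split => //; exists a.
have IH c c' : node c -> node c' -> c' < a' -> c < c' -> up_closure (B c) c'.
  move=> nc nc' c'a' cc'; apply: contrapT => nBc.
  by apply: (bad_min c' c'a'); split => //; exists c.
case: na' aa' nB IH => {bad_min} [{}a' [_ _ a'min] aa' _ _|].
  exact: a'min aa' I (node_good na).
move=> p {}a' np [Ba' ga' a'min] aa' nB IH.
have pa' : p < a' by have [b Bb ba'] := Ba'; exact: lt_le_trans (B_gt np Bb) ba'.
have [ap|pa] := tree_comparable hT (ltW aa') (ltW pa').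
  move: ap; rewrite le_eqVlt => /predU1P[ap|ap]; first by apply: nB; rewrite ap.
  exact/nB/(up_closure_le (ltW pa'))/IH.
move: pa; rewrite le_eqVlt => /predU1P[pa|pa]; first by apply: nB; rewrite -pa.
exact: a'min aa' (IH p a np na aa' pa) (node_good na).
Qed.

(** The nodes below [a] are [a] itself and those below the node [p] from which [a]
arises: by [node_lt_above] a node strictly between [p] and [a] would be a good
element above [B p], against the minimality of [a]. *)
Lemma node_finite_below a : node a -> finite_set [set c | node c /\ c <= a].
Proof.
elim=> [{}a [_ ga amin]|p {}a np IH [Ba ga amin]].
  apply: sub_finite_set (finite_set1 a) => c [nc].
  rewrite le_eqVlt => /predU1P[->//|ca].
  by have := amin c ca I (node_good nc).
have pa : p < a by have [b Bb ba] := Ba; exact: lt_le_trans (B_gt np Bb) ba.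
have : finite_set ([set c | node c /\ c <= p] `|` [set a]).
  by rewrite finite_setU; split.
apply: sub_finite_set => c [nc ca]; move: (ca).
rewrite le_eqVlt => /predU1P[->|ca']; first by right.
left; split => //; have [//|] := tree_comparable hT ca (ltW pa).
rewrite le_eqVlt => /predU1P[->//|pc].
by have := amin c ca' (node_lt_above np nc pc) (node_good nc).
Qed.

Lemma first_good_ex (Q : ray_space T) (X : set T) s :
  ray_set Q s -> X s -> good s ->
  exists2 a, ray_set Q a & first_good X a.
Proof.
move=> Qs Xs gs.
have [|a [[Xa ga] Qa] amin] := @tree_min d T hT ((X `&` good) `&` ray_set Q).
  by exists s.
exists a => //; split => // c ca Xc gc; apply: (amin c ca); split => //.
exact: ray_down (ltW ca) Qa.
Qed.

End Nodes.

(** * The closed discrete set *)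

Section Centers.
Context {d : Order.disp_t} {T : porderType d} (hT : is_tree T).
Context (U : ray_space T -> set (ray_space T)).
Context (hU : forall R, nbhs R (U R)).
Context (S : T -> set (ray_space T)) (B : T -> set T).
Context (SB : forall t, fin_cover U t (S t) (B t)).
Implicit Types (a b c p : T).

Let nd := node (good U) B.

(** The inequality is strict because nodes are good and elements of [B a] are not. *)
Lemma node_lt_B a b : nd a -> B a b -> a < b.
Proof.
move=> /node_good ga Bb; have [_ _ /(_ b Bb)[ab ngb] _] := SB a.
by rewrite lt_neqAle ab andbT; apply: contra_notN ngb => /eqP<-.
Qed.

(** If [B a] met [Q] for every node [a] in [Q], these nodes would form a chain
without maximum, generating a ray [R] that is guarded by some such [a].  Between [a] and a later node lies an element of [B a]; it would guard [R] as well,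
and elements of [B a] are not good. *)
Lemma last_node (Q : ray_space T) :
  exists a, [/\ nd a, ray_set Q a & forall b, B a b -> ~ ray_set Q b].
Proof.
apply: contrapT => none.
have step a : nd a -> ray_set Q a -> exists2 b, B a b & ray_set Q b.
  move=> na Qa; apply: contrapT => nb; apply: none; exists a; split => // b Bb Qb.
  by apply: nb; exists b.
have [q [Qq qF]] := guards_ex hU Q.
have gQ : guards U q Q by [].
have next a : nd a -> ray_set Q a ->
    exists a' b, [/\ nd a', ray_set Q a', B a b, a < b & b <= a'].
  move=> na Qa; have [b Bb Qb] := step a na Qa.
  (* Late elements of [Q] guard [Q], so [Q] contains a good element above [b]. *)
  have [s [Qs bs qs]] : exists s, [/\ ray_set Q s, b <= s & q <= s].
    by have [|] := ray_total Qb Qq; [exists q|exists b].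
  have [||a' Qa' fa'] := first_good_ex hT (X := up_closure (B a)) (good := good U) Qs.
  - by exists b.
  - by exists Q; exact: guards_le gQ qs Qs.
  have [[b' Bb' b'a'] _ _] := fa'.
  by exists a', b'; split => //; [exact: node_next fa'|exact: node_lt_B].
pose C := [set a | nd a /\ ray_set Q a].
have C0 : C !=set0.
  have [||a Qa fa] := first_good_ex hT (X := setT) (good := good U) Qq.
  - by [].
  - by exists Q.
  by exists a; split => //; exact: node_root.
have Ctot : total_on C <=%O by move=> a a' [_ Qa] [_ Qa']; exact: ray_total Qa Qa'.
have Cnomax a : C a -> exists2 a', C a' & a < a'.
  move=> [na Qa]; have [a' [b [na' Qa' _ ab ba']]] := next a na Qa.
  by exists a' => //; exact: lt_le_trans ba'.
have [R RE] := ray_of_set (chain_down_ray hT C0 Ctot Cnomax).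
have [s gs] := guards_ex hU R.
have [a [na Qa] sa] : exists2 a, C a & s <= a by case: gs; rewrite RE.
have [a' [b [na' Qa' Bb ab ba']]] := next a na Qa.
have [_ _ /(_ b Bb)[_ ngb] _] := SB a; apply: ngb; exists R.
apply: guards_le gs (le_trans sa (ltW ab)) _.
by rewrite RE; exists a'.
Qed.

Definition centers := \bigcup_(a in nd) S a.

Lemma bigcup_centers : \bigcup_(R in centers) U R = setT.
Proof.
apply/seteqP; split => // Q _; have [a [na Qa QB]] := last_node Q.
have [_ _ _ /(_ Q Qa)[[R SR UQ]|[b Bb Qb]]] := SB a; last by case: (QB b Bb).
by exists R => //; exists a.
Qed.

(** For a node [a] in [Q] with [B a] disjoint from [Q], the rays through [a] that
avoid [B a] form a neighborhood of [Q].  It only meets the finite sets [S c] of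
the finitely many nodes [c <= a], as larger nodes lie above
some element of [B a]. *)
Lemma centers_locally_finite (Q : ray_space T) :
  exists2 W, nbhs Q W & finite_set (W `&` centers).
Proof.
have [a [na Qa QB]] := last_node Q.
have [[_ Bfin] _ _ _] := SB a.
exists (ray_cone a (B a)).
  apply: filterI.
    by apply: filterS (near_ray_mem a Q) => R ->.
  exact: near_ray_avoid.
have : finite_set (\bigcup_(c in [set c | nd c /\ c <= a]) S c).
  apply: bigcup_finite; first exact: (node_finite_below hT node_lt_B).
  by move=> c _; have [[]] := SB c.
apply: sub_finite_set => R [[Ra RB] [c nc SR]]; exists c => //; split => //.
have [_ /(_ R SR) Rc _ _] := SB c.
have [//|] := ray_total Rc Ra; rewrite le_eqVlt => /predU1P[->//|ac].
have [b Bb bc] := node_lt_above hT node_lt_B na nc ac.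
by case: (RB b Bb); exact: ray_down Rc.
Qed.

End Centers.

Theorem proposition3p2 (d : Order.disp_t) (T : porderType d) (hT : is_tree T) :
  D_space (ray_space T).
Proof.
move=> U oU; have hU R : nbhs R (U R) by exact: open_nbhs_nbhs.
have /choice[SB hSB] : forall t, exists SB, fin_cover U t SB.1 SB.2.
  by move=> t; have [S [B SB]] := all_coverable hT hU t; exists (S, B).
pose D := centers U (fun t => (SB t).1) (fun t => (SB t).2).
have [Dcl Ddisc] := locally_finite_closed_discrete (centers_locally_finite hT hU hSB).
exists D; split => //.
by have := bigcup_centers hT hU hSB.
Qed.
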